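(* Let $M > 0$ be a fixed real number and $\alpha \in \mathbb{R}$. Define $$K(\alpha) = \frac{|\alpha^2-1|M^2}{2}, \qquad J(\alpha) = 2|\alpha(1-\alpha^2)|M^3 .$$ Then, for any integer $n \ge \frac{4M}{\pi}$, the following estimate holds for all real $x$ with $|x| \le M$: $$\left| \left( \cos\frac{x}{n} + i \alpha \sin\frac{x}{n} \right)^n - e^{i \alpha x} \right| \leq \frac{1}{n} \sqrt{ K(\alpha)^2 e^{2K(\alpha)/n} + \frac{J(\alpha)^2}{n^2} e^{K(\alpha)/n} }.$$
   Context: Here $i$ is the imaginary unit and $|\cdot|$ is the modulus of a complex number. *)

(* Defs.v *)
From Stdlib Require Import Reals.
From Coquelicot Require Import Coquelicot.

Open Scope R_scope.

(* Coquelicot has no complex exponential: e^(a + i b) = e^a (cos b + i sin b). *)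
Definition Cexp (z : C) : C :=
  (RtoC (exp (Re z)) * (RtoC (cos (Im z)) + Ci * RtoC (sin (Im z))))%C.

Definition K (M alpha : R) : R := Rabs (alpha ^ 2 - 1) * M ^ 2 / 2.

Definition J (M alpha : R) : R := 2 * Rabs (alpha * (1 - alpha ^ 2)) * M ^ 3.

(* Main.v *)
Require Import Defs.
From Stdlib Require Import Reals Lra.
From Coquelicot Require Import Coquelicot.

Open Scope R_scope.

(** Put [t = x / n]; the hypothesis on [n] says [|t| <= PI / 4], so
    [cos t + i alpha sin t] lies in the right half-plane and has the polar form
    [r e^(i theta)] with [theta = atan (alpha tan t)] and
    [r^2 = 1 + (alpha^2 - 1) sin^2 t].  By de Moivre the quantity to estimate is
    the distance between [r^n e^(i n theta)] and [e^(i alpha x)], whose square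
    splits into a radial and an angular part,
    [(r^n - 1)^2 + 2 r^n (1 - cos (n theta - alpha x))]
    ([Cmod_polar_sub_unit]).  These give the two terms under the square root.

    Radial part: [|r^2 - 1| <= 2 K / n^2], so each factor [r] differs from 1 by
    about [K / n^2], and [n] factors by about [K / n] ([pow_sub_one_bound]).

    Angular part: [theta - alpha t] vanishes to third order at [t = 0], since
    its derivative is [alpha (1 - alpha^2) sin^2 t / (cos^2 t + alpha^2 sin^2 t)],
    where the denominator is at least [cos^2 t >= 1/2].  Hence
    [|theta - alpha t| <= J / n^3] ([atan_phase_error]), and
    [n theta - alpha x] is at most [J / n^2]. *)

(** * Powers of a number close to 1 *)

Lemma pow_le_exp (r k : R) (n : nat) :
  0 < r -> Rabs (r ^ 2 - 1) <= 2 * k -> r ^ n <= exp (INR n * k).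
Proof.
  intros Hr Hk.
  assert (Hrk : r <= exp k).
  { pose proof (exp_ineq1_le k). pose proof (Rle_abs (r ^ 2 - 1)).
    pose proof (pow2_ge_0 (r - 1)). nra. }
  replace (exp (INR n * k)) with (exp k ^ n).
  - apply pow_incr; lra.
  - rewrite <- Rpower_pow by apply exp_pos.
    unfold Rpower. now rewrite ln_exp.
Qed.

Lemma bernoulli_one_sub (r : R) (n : nat) :
  0 <= r <= 1 -> 1 - r ^ n <= INR n * (1 - r).
Proof.
  intros Hr. induction n as [|n IH].
  - simpl; lra.
  - rewrite S_INR; simpl.
    assert (0 <= r ^ n <= 1).
    { split; [now apply pow_le|]. rewrite <- (pow1 n). now apply pow_incr. }
    nra.
Qed.

(** When [r >= 1] the bound comes from [e^y - 1 <= y e^y].  When [r < 1], Bernoulli's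
    inequality leaves [n (1 - r)] to estimate, and
    [1 - r <= (v / 2) (1 + v / 2)] with [v = 1 - r^2]; this last inequality
    fails for [r] near 0, hence the lower bound on [r^2]. *)
Lemma pow_sub_one_bound (r k : R) (n : nat) :
  0 < r -> 1 / 2 <= r ^ 2 -> (1 <= n)%nat -> Rabs (r ^ 2 - 1) <= 2 * k ->
  Rabs (r ^ n - 1) <= INR n * k * exp (INR n * k).
Proof.
  intros Hr Hhalf Hn Hk.
  assert (HN : 1 <= INR n) by (apply (le_INR 1); exact Hn).
  assert (Hk0 : 0 <= k) by (pose proof (Rabs_pos (r ^ 2 - 1)); lra).
  pose proof (exp_pos (INR n * k)) as He.
  destruct (Rle_dec 1 r) as [H1|H1].
  - pose proof (pow_le_exp r k n Hr Hk) as Hup.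
    pose proof (pow_R1_Rle r n H1) as Hlow.
    rewrite Rabs_right by lra.
    pose proof (exp_ineq1_le (- (INR n * k))) as Hneg.
    assert (Hinv : exp (INR n * k) * exp (- (INR n * k)) = 1).
    { rewrite <- exp_plus, Rplus_opp_r. apply exp_0. }
    nra.
  - assert (Hr1 : 0 <= r <= 1) by lra.
    pose proof (bernoulli_one_sub r n Hr1) as Hber.
    assert (Hle : r ^ n <= 1) by (rewrite <- (pow1 n); now apply pow_incr).
    rewrite Rabs_left1 by lra.
    rewrite Rabs_left1 in Hk by nra.
    assert (Hstep : 1 - r <= k * (1 + k)).
    { (* With [v = 1 - r^2], [(v / 2) (1 + v / 2) - (1 - r)] factors as
         [(1 - r)^2 (r^2 + 2 r - 1) / 4]. *)
      assert (Hfac : 0 <= (1 - r) ^ 2 * (r ^ 2 + 2 * r - 1)).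
      { apply Rmult_le_pos; [apply pow2_ge_0 | nra]. }
      assert (Hv : 1 - r <= (1 - r ^ 2) / 2 * (1 + (1 - r ^ 2) / 2)) by nra.
      assert (0 <= (1 - r ^ 2) / 2 <= k) by nra.
      nra. }
    pose proof (exp_ineq1_le (INR n * k)) as Hexp.
    assert (Hkn : k <= INR n * k) by nra.
    assert (Hnk : 0 <= INR n * k) by nra.
    assert (INR n * (1 - r) <= INR n * (k * (1 + k)))
      by (apply Rmult_le_compat_l; lra).
    assert (INR n * k * (1 + k) <= INR n * k * exp (INR n * k))
      by (apply Rmult_le_compat_l; lra).
    lra.
Qed.

(** * Polar form *)

Lemma Cpow_polar (r theta : R) (n : nat) :
  Cpow (r * cos theta, r * sin theta) n
  = (r ^ n * cos (INR n * theta), r ^ n * sin (INR n * theta)).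
Proof.
  induction n as [|n IH].
  - simpl. rewrite Rmult_0_l, cos_0, sin_0.
    unfold RtoC. f_equal; ring.
  - change (Cpow (r * cos theta, r * sin theta) (S n))
      with (Cmult (r * cos theta, r * sin theta)
                  (Cpow (r * cos theta, r * sin theta) n)).
    rewrite IH, S_INR, Rmult_plus_distr_r, Rmult_1_l, cos_plus, sin_plus.
    unfold Cmult; simpl. f_equal; ring.
Qed.

Lemma Cmod_polar_sub_unit (p a b : R) :
  Cmod (Cminus (p * cos a, p * sin a) (cos b, sin b))
  = sqrt ((p - 1) ^ 2 + p * (2 * (1 - cos (a - b)))).
Proof.
  unfold Cmod, Cminus, Cplus, Copp; simpl. f_equal.
  pose proof (sin2_cos2 a) as Ha. pose proof (sin2_cos2 b) as Hb.
  unfold Rsqr in *. rewrite cos_minus.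
  replace ((p * cos a + - cos b) * ((p * cos a + - cos b) * 1)
           + (p * sin a + - sin b) * ((p * sin a + - sin b) * 1))
    with (p ^ 2 * (sin a * sin a + cos a * cos a)
          + (sin b * sin b + cos b * cos b)
          - 2 * p * (cos a * cos b + sin a * sin b)) by ring.
  rewrite Ha, Hb. ring.
Qed.

Lemma Rabs_sin_le (y : R) : Rabs (sin y) <= Rabs y.
Proof.
  destruct (MVT_gen sin 0 y cos) as [c [_ Hc]].
  - intros u _. apply is_derive_Reals, derivable_pt_lim_sin.
  - intros u _. apply continuity_sin.
  - rewrite sin_0, !Rminus_0_r in Hc. rewrite Hc, Rabs_mult.
    pose proof (COS_bound c) as Hcos. apply Rabs_le in Hcos.
    pose proof (Rabs_pos y). nra.
Qed.

Lemma sqr_le_of_Rabs_le (a b : R) : Rabs a <= b -> a ^ 2 <= b ^ 2.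
Proof.
  intros H. rewrite <- (pow2_abs a). apply pow_incr.
  split; [apply Rabs_pos | exact H].
Qed.

Lemma two_one_sub_cos_le (d : R) : 2 * (1 - cos d) <= d ^ 2.
Proof.
  replace d with (2 * (d / 2)) at 1 by field. rewrite cos_2a_sin.
  pose proof (sqr_le_of_Rabs_le _ _ (Rabs_sin_le (d / 2))) as H.
  rewrite pow2_abs in H. nra.
Qed.

Lemma cos_sqr_ge_half (t : R) :
  Rabs t <= PI / 4 -> 0 < cos t /\ 1 / 2 <= cos t ^ 2.
Proof.
  intros Ht. apply Rabs_le_between in Ht. pose proof PI_RGT_0. split.
  - apply cos_gt_0; lra.
  - assert (H2 : 0 <= cos (2 * t)) by (apply cos_ge_0; lra).
    rewrite cos_2a_cos in H2. nra.
Qed.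

(** * The angular error *)

(** The derivative of [atan (alpha tan s) - alpha s] is
    [alpha (1 - alpha^2) sin^2 s / (cos^2 s + alpha^2 sin^2 s)], of second
    order in [s], so the mean value theorem makes the difference cubic. *)
Lemma atan_phase_error (alpha t : R) :
  Rabs t <= PI / 4 ->
  Rabs (atan (alpha * (sin t / cos t)) - alpha * t)
  <= 2 * Rabs (alpha * (1 - alpha ^ 2)) * Rabs t ^ 3.
Proof.
  intros Ht.
  set (f := fun s => atan (alpha * (sin s / cos s)) - alpha * s).
  set (df := fun s => alpha * (1 - alpha ^ 2) * sin s ^ 2
                      / (cos s ^ 2 + alpha ^ 2 * sin s ^ 2)).
  assert (Hbetween : forall s, Rmin 0 t <= s <= Rmax 0 t -> Rabs s <= Rabs t).
  { intros s Hs. unfold Rmin, Rmax in Hs. destruct (Rle_dec 0 t).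
    - rewrite !Rabs_right; lra.
    - rewrite !Rabs_left1; lra. }
  assert (Hder : forall s, Rabs s <= Rabs t -> is_derive f s (df s)).
  { intros s Hs.
    destruct (cos_sqr_ge_half s) as [Hc Hc2]; [lra|].
    assert (Hc0 : cos s <> 0) by lra.
    assert (Hq : cos s ^ 2 + alpha ^ 2 * sin s ^ 2 <> 0).
    { pose proof (pow2_ge_0 (alpha * sin s)). nra. }
    unfold f, df. auto_derive; [exact Hc0|].
    field. repeat split; try exact Hc0.
    all: intro H0; apply Hq; rewrite <- H0; ring. }
  destruct (MVT_gen f 0 t df) as [c [Hc Heq]].
  - intros s Hs. apply Hder, Hbetween. lra.
  - intros s Hs. apply derivable_continuous_pt. exists (df s).
    apply is_derive_Reals, Hder, Hbetween, Hs.
  - apply Hbetween in Hc.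
    assert (Hf0 : f 0 = 0).
    { unfold f. rewrite sin_0. unfold Rdiv.
      rewrite !Rmult_0_l, !Rmult_0_r, atan_0. ring. }
    rewrite Hf0, !Rminus_0_r in Heq. fold (f t). rewrite Heq, Rabs_mult.
    replace (Rabs t ^ 3) with (Rabs t ^ 2 * Rabs t) by ring.
    rewrite <- Rmult_assoc. apply Rmult_le_compat_r; [apply Rabs_pos|].
    unfold df, Rdiv. rewrite !Rabs_mult, Rabs_inv, <- Rabs_mult.
    destruct (cos_sqr_ge_half c) as [_ Hc2]; [lra|].
    pose proof (pow2_ge_0 (alpha * sin c)) as Hsq.
    assert (Hq : 1 / 2 <= cos c ^ 2 + alpha ^ 2 * sin c ^ 2) by nra.
    rewrite (Rabs_right (cos c ^ 2 + _)) by lra.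
    rewrite (Rabs_right (sin c ^ 2)) by (apply Rle_ge, pow2_ge_0).
    assert (Hinv : / (cos c ^ 2 + alpha ^ 2 * sin c ^ 2) <= 2).
    { rewrite <- (Rinv_inv 2). apply Rinv_le_contravar; lra. }
    assert (Hs : sin c ^ 2 <= Rabs t ^ 2).
    { apply sqr_le_of_Rabs_le. pose proof (Rabs_sin_le c). lra. }
    rewrite Rmult_assoc.
    replace (2 * Rabs (alpha * (1 - alpha ^ 2)) * Rabs t ^ 2)
      with (Rabs (alpha * (1 - alpha ^ 2)) * (Rabs t ^ 2 * 2)) by ring.
    apply Rmult_le_compat_l; [apply Rabs_pos|].
    apply Rmult_le_compat; [apply pow2_ge_0 | | exact Hs | exact Hinv].
    left. apply Rinv_0_lt_compat. lra.
Qed.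

(** * The estimate *)

(** Dividing by [cos theta] instead of taking a square root makes
    [r cos theta = cos t] immediate and gives
    [r sin theta = cos t * tan theta = alpha sin t]. *)
Lemma elliptic_polar_form (alpha t : R) :
  0 < cos t ->
  let theta := atan (alpha * (sin t / cos t)) in
  exists r, 0 < r /\ r * cos theta = cos t /\ r * sin theta = alpha * sin t
            /\ r ^ 2 = 1 + (alpha ^ 2 - 1) * sin t ^ 2.
Proof.
  intros Hc theta.
  assert (Hct : 0 < cos theta).
  { destruct (atan_bound (alpha * (sin t / cos t))). apply cos_gt_0; unfold theta; lra. }
  assert (Htan : sin theta / cos theta = alpha * (sin t / cos t)) by apply tan_atan.
  set (r := cos t / cos theta).
  assert (H1 : r * cos theta = cos t) by (unfold r; field; lra).
  assert (H2 : r * sin theta = alpha * sin t).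
  { replace (r * sin theta) with (cos t * (sin theta / cos theta))
      by (unfold r; field; lra).
    rewrite Htan. field. lra. }
  exists r. repeat split; trivial.
  - unfold r. now apply Rdiv_lt_0_compat.
  - pose proof (sin2_cos2 theta) as Htheta. pose proof (sin2_cos2 t) as Ht.
    unfold Rsqr in *.
    replace (r ^ 2) with (r ^ 2 * (sin theta * sin theta + cos theta * cos theta))
      by (rewrite Htheta; ring).
    replace (r ^ 2 * (sin theta * sin theta + cos theta * cos theta))
      with ((r * sin theta) ^ 2 + (r * cos theta) ^ 2) by ring.
    rewrite H1, H2. nra.
Qed.

Theorem theorem2p2 :
  forall (M : R) (alpha : R), 0 < M ->
  forall n : nat, INR n >= 4 * M / PI ->
  forall x : R, Rabs x <= M ->
    Cmod (Cpow (RtoC (cos (x / INR n)) + Ci * RtoC alpha * RtoC (sin (x / INR n)))%C n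
          - Cexp (Ci * RtoC alpha * RtoC x))%C
    <= 1 / INR n *
       sqrt ((K M alpha) ^ 2 * exp (2 * K M alpha / INR n)
             + (J M alpha) ^ 2 / (INR n) ^ 2 * exp (K M alpha / INR n)).
Proof.
  intros M alpha HM n Hn x Hx.
  pose proof PI_RGT_0 as HPI.
  assert (HN : 0 < INR n).
  { apply Rlt_le_trans with (4 * M / PI); [|lra]. apply Rdiv_lt_0_compat; lra. }
  assert (Hn1 : (1 <= n)%nat) by exact (INR_lt 0 n HN).
  set (t := x / INR n).
  assert (Hxt : INR n * t = x) by (unfold t; field; lra).
  assert (HtM : Rabs t <= M / INR n).
  { unfold t, Rdiv. rewrite Rabs_mult, Rabs_inv, (Rabs_right (INR n)) by lra.
    apply Rmult_le_compat_r; [|exact Hx]. left. now apply Rinv_0_lt_compat. }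
  assert (HMn : M / INR n <= PI / 4).
  { apply Rmult_le_reg_r with (INR n * 4 / PI).
    - apply Rdiv_lt_0_compat; lra.
    - replace (M / INR n * (INR n * 4 / PI)) with (4 * M / PI) by (field; lra).
      replace (PI / 4 * (INR n * 4 / PI)) with (INR n) by (field; lra). lra. }
  assert (Ht : Rabs t <= PI / 4) by lra.
  destruct (cos_sqr_ge_half t Ht) as [Hc Hc2].
  set (theta := atan (alpha * (sin t / cos t))).
  destruct (elliptic_polar_form alpha t Hc) as (r & Hr & Hrc & Hrs & Hr2).
  fold theta in Hrc, Hrs.
  assert (Hbase : (RtoC (cos t) + Ci * RtoC alpha * RtoC (sin t))%C
                  = (r * cos theta, r * sin theta)).
  { rewrite Hrc, Hrs. unfold Ci, RtoC, Cplus, Cmult; simpl. f_equal; ring. }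
  assert (Hlim : Cexp (Ci * RtoC alpha * RtoC x)%C = (cos (alpha * x), sin (alpha * x))).
  { replace (Ci * RtoC alpha * RtoC x)%C with ((0, alpha * x) : C)
      by (unfold Ci, RtoC, Cmult; simpl; f_equal; ring).
    unfold Cexp, Ci, RtoC, Cplus, Cmult; simpl. rewrite exp_0. f_equal; ring. }
  rewrite Hbase, Hlim, Cpow_polar, Cmod_polar_sub_unit.
  set (k := K M alpha / INR n ^ 2).
  assert (Hnk : INR n * k = K M alpha / INR n) by (unfold k; field; lra).
  assert (Ht2 : t ^ 2 <= (M / INR n) ^ 2) by (now apply sqr_le_of_Rabs_le).
  assert (Hsin : sin t ^ 2 <= (M / INR n) ^ 2).
  { apply sqr_le_of_Rabs_le. pose proof (Rabs_sin_le t). lra. }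
  assert (Hk : Rabs (r ^ 2 - 1) <= 2 * k).
  { replace (r ^ 2 - 1) with ((alpha ^ 2 - 1) * sin t ^ 2) by (rewrite Hr2; ring).
    rewrite Rabs_mult, (Rabs_right (sin t ^ 2)) by (apply Rle_ge, pow2_ge_0).
    replace (2 * k) with (Rabs (alpha ^ 2 - 1) * (M / INR n) ^ 2)
      by (unfold k, K; field; lra).
    apply Rmult_le_compat_l; [apply Rabs_pos | exact Hsin]. }
  assert (Hhalf : 1 / 2 <= r ^ 2).
  { pose proof (sin2_cos2 t) as H1. unfold Rsqr in H1.
    pose proof (pow2_ge_0 (alpha * sin t)). nra. }
  assert (Hradial : (r ^ n - 1) ^ 2
                    <= (K M alpha / INR n * exp (K M alpha / INR n)) ^ 2).
  { apply sqr_le_of_Rabs_le. rewrite <- Hnk. now apply pow_sub_one_bound. }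
  assert (Hphase : Rabs (INR n * theta - alpha * x) <= J M alpha / INR n ^ 2).
  { replace (INR n * theta - alpha * x) with (INR n * (theta - alpha * t))
      by (rewrite <- Hxt; ring).
    rewrite Rabs_mult, (Rabs_right (INR n)) by lra.
    replace (J M alpha / INR n ^ 2)
      with (INR n * (2 * Rabs (alpha * (1 - alpha ^ 2)) * (M / INR n) ^ 3))
      by (unfold J; field; lra).
    apply Rmult_le_compat_l; [lra|].
    apply Rle_trans with (1 := atan_phase_error alpha t Ht).
    apply Rmult_le_compat_l.
    - apply Rmult_le_pos; [lra | apply Rabs_pos].
    - apply pow_incr. split; [apply Rabs_pos | exact HtM]. }
  assert (Hangular : r ^ n * (2 * (1 - cos (INR n * theta - alpha * x)))
                     <= exp (K M alpha / INR n) * (J M alpha / INR n ^ 2) ^ 2).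
  { apply Rmult_le_compat.
    - now apply pow_le, Rlt_le.
    - pose proof (COS_bound (INR n * theta - alpha * x)). lra.
    - rewrite <- Hnk. now apply pow_le_exp.
    - apply Rle_trans with (1 := two_one_sub_cos_le _). now apply sqr_le_of_Rabs_le. }
  replace (1 / INR n) with (sqrt ((1 / INR n) ^ 2))
    by (apply sqrt_pow2; left; apply Rdiv_lt_0_compat; lra).
  rewrite <- sqrt_mult_alt by apply pow2_ge_0.
  apply sqrt_le_1_alt.
  replace (exp (2 * K M alpha / INR n)) with (exp (K M alpha / INR n) ^ 2).
  - apply Rle_trans with (1 := Rplus_le_compat _ _ _ _ Hradial Hangular).
    right. field. lra.
  - replace (2 * K M alpha / INR n) with (K M alpha / INR n + K M alpha / INR n)
      by (field; lra).
    rewrite exp_plus. ring.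
Qed.
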